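(* Let $(X,S)$ and $(Y,T)$ be two transformation monoids. Suppose that $T\neq\{1\}$ has trivial group of units and that $|Y|=n$. Let $A'$ be a generating set of $U_S^Y$ of minimum size. Then $$N(S^Y\rtimes T)\le \max\{n,\ \mathrm{diam}(U_S^Y,A')\}\,N(S)+N(T).$$ Furthermore, if $\mathrm{rank}(U_S^k)=k\,\mathrm{rank}(U_S)$ for all $k\ge 1$, then $$N(S^Y\rtimes T)\le n\,N(S)+N(T).$$
   Context: A transformation monoid $(X,S)$ is a finite monoid $S$ acting faithfully on the right of a finite set $X$, with the identity of $S$ acting as the identity map. For transformation monoids $(X,S)$ and $(Y,T)$, $S^Y$ is the monoid of all functions $Y\to S$ under pointwise multiplication (functions written on the right), and $S^Y\rtimes T$ is the semigroup of the wreath product $(X,S)\wr(Y,T)$: its underlying set is $S^Y\times T$, with product $(f,t)(g,u)=(f\cdot{}^{t}g,\,tu)$, where ${}^{t}g:Y\to S$ is given by $y\,({}^{t}g)=(yt)g$. $U_S$ is the group of units of $S$, $U_S^Y$ is the group of all functions $Y\to U_S$ under pointwise multiplication, and $U_S^k$ is the $k$-fold direct power. A generating set of a finite semigroup $R$ is a non-empty subset $A\subseteq R$ such that every element of $R$ is a product of one or more elements of $A$; $\mathrm{rank}(R)$ is the smallest cardinality of a generating set (so the trivial group has rank $1$); groups and monoids are regarded as semigroups. For a generating set $A$ of $R$ and $s\in R$, the length $l_A(s)$ is the least $k$ such that $s=a_1\cdots a_k$ with $a_i\in A$, except that the identity element of $R$ (if there is one) has length $0$ by convention. $\ker(R)$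 is the minimum ideal of $R$, $N(R,A)=\min\{l_A(s): s\in\ker(R)\}$, and $N(R)$ is the minimum of $N(R,A)$ over all generating sets $A$ with $|A|=\mathrm{rank}(R)$. For a finite group $G$ with generating set $A$, $\mathrm{diam}(G,A)=\max\{l_A(g):g\in G\}$. *)

(* Defs.v *)
From HB Require Import structures.
From mathcomp Require Import all_boot.
From mathcomp Require Import boolp.

Set Implicit Arguments.
Unset Strict Implicit.
Unset Printing Implicit Defensive.

Local Open Scope group_scope.

#[short(type="finSemigroupType")]
HB.structure Definition FinSemigroup := {R of Semigroup R & Finite R}.

#[short(type="finMonoidType")]
HB.structure Definition FinMonoid := {M of Monoid M & Finite M}.

HB.saturate finfun_of.

(* The least natural number satisfying P (0 if there is none). *)
Definition least (P : nat -> Prop) : nat :=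
  if pselect (exists n, `[<P n>]) is left exP then ex_minn exP else 0%N.

Lemma leastP (P : nat -> Prop) (n : nat) :
  P n -> P (least P) /\ (forall m, P m -> least P <= m)%N.
Proof.
move=> Pn; rewrite /least; case: pselect => [exP | []]; last first.
  by exists n; apply/asboolP.
by case: ex_minnP => m /asboolP Pm min_m; split=> // k /asboolP/min_m.
Qed.

Section FiniteSemigroups.

Variable R : finSemigroupType.
Implicit Types (A I : {set R}) (s e : R).

(* product_of A k s : s = a_1 * ... * a_k with all a_i in A, where k >= 1. *)
Inductive product_of A : nat -> R -> Prop :=
| Product1 a of a \in A : product_of A 1 a
| ProductS k s a of product_of A k s & a \in A : product_of A k.+1 (s * a).

Definition generates A : Prop :=
  A != set0 /\ forall s, exists k, product_of A k s.

Definition is_identity e : Prop := forall s, e * s = s /\ s * e = s.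

Definition len A s : nat :=
  if `[<is_identity s>] then 0%N else least (fun k => product_of A k s).

Definition ideal I : bool :=
  (I != set0) &&
  [forall s, forall x in I, (s * x \in I) && (x * s \in I)].

(* The minimum ideal: see ideal_ker and ker_sub. *)
Definition ker : {set R} := \bigcap_(I : {set R} | ideal I) I.

Lemma ker_sub I : ideal I -> ker \subset I.
Proof. by move=> idI; apply: bigcap_inf. Qed.

Lemma ideal_ker (s0 : R) : ideal ker.
Proof.
have idI2 I J : ideal I -> ideal J -> ideal (I :&: J).
  case/andP=> /set0Pn[x Ix] /forallP idI /andP[/set0Pn[y Jy] /forallP idJ].
  apply/andP; split.
    apply/set0Pn; exists (x * y); rewrite inE.
    have /forall_inP/(_ x Ix)/andP[_ ->] := idI y.
    by have /forall_inP/(_ y Jy)/andP[-> _] := idJ x.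
  apply/forallP => s; apply/forall_inP => z; rewrite inE => /andP[Iz Jz].
  have /forall_inP/(_ z Iz)/andP[I1 I2] := idI s.
  have /forall_inP/(_ z Jz)/andP[J1 J2] := idJ s.
  by rewrite !inE I1 I2 J1 J2.
apply: (big_ind ideal) => //.
apply/andP; split; first by apply/set0Pn; exists s0.
by apply/forallP => s; apply/forall_inP => x _; rewrite !inE.
Qed.

(* N(R, A), and N(R) in Nker below *)
Definition Nker_wrt A : nat :=
  least (fun k => exists2 s, s \in ker & len A s = k).

(* The diameter when R is a group. *)
Definition diam A : nat := \max_(g : R) len A g.

End FiniteSemigroups.

Definition rank (R : finSemigroupType) : nat :=
  least (fun k => exists2 A : {set R}, generates A & #|A| = k).

Definition Nker (R : finSemigroupType) : nat :=
  least (fun k => exists A : {set R},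
    [/\ generates A, #|A| = rank R & Nker_wrt A = k]).

Section Units.

Variable S : finMonoidType.

Definition units : {set S} :=
  [set x : S | [exists y : S, (x * y == 1) && (y * x == 1)]].

Record unit_group := UnitGroup { unit_val : S; unit_valP : unit_val \in units }.

HB.instance Definition _ := [isSub for unit_val].
HB.instance Definition _ := [Finite of unit_group by <:].

Fact units_closed : umagma_closed (mem units).
Proof.
split; first by rewrite !inE; apply/existsP; exists 1; rewrite mulg1 eqxx.
move=> x y; rewrite !inE.
case/existsP=> x' /andP[/eqP xx' /eqP x'x].
case/existsP=> y' /andP[/eqP yy' /eqP y'y].
apply/existsP; exists (y' * x').
by rewrite !mulgA -(mulgA x) yy' mulg1 xx' -(mulgA y') x'x mulg1 y'y !eqxx.
Qed.

HB.instance Definition _ :=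
  SubChoice_isSubMonoid.Build S (mem units) unit_group units_closed.

Fact unit_has_inverse (u : unit_group) :
  exists v : unit_group, (v * u == 1) && (u * v == 1).
Proof.
have := valP u; rewrite inE => /existsP[y /andP[uy yu]].
have Uy : y \in units by rewrite inE; apply/existsP; exists (val u); rewrite yu.
exists (Sub y Uy).
by rewrite -!val_eqE /= yu uy.
Qed.

Definition unit_inv (u : unit_group) : unit_group := xchoose (unit_has_inverse u).

HB.instance Definition _ := hasInv.Build unit_group unit_inv.

Fact unit_mulVg : left_inverse 1 unit_inv *%g.
Proof. by move=> u; case/andP: (xchooseP (unit_has_inverse u)) => /eqP. Qed.

Fact unit_mulgV : right_inverse 1 unit_inv *%g.
Proof. by move=> u; case/andP: (xchooseP (unit_has_inverse u)) => _ /eqP. Qed.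

HB.instance Definition _ :=
  Monoid_isGroup.Build unit_group unit_mulVg unit_mulgV.

End Units.

Record transMonoid (X : finType) (S : finMonoidType) := TransMonoid {
  tm_act :> X -> S -> X;
  tm_act1 : forall x, tm_act x 1 = x;
  tm_actM : forall x s t, tm_act x (s * t) = tm_act (tm_act x s) t;
  tm_faithful : forall s t, (forall x, tm_act x s = tm_act x t) -> s = t
}.

(* The semigroup of the wreath product of a and b. It is an alias indexed by the
   two actions, so that its product is not the componentwise one of pairs. *)
Definition wreath (X Y : finType) (S T : finMonoidType)
  (a : transMonoid X S) (b : transMonoid Y T) : Type := ({ffun Y -> S} * T)%type.

Section WreathProduct.

Variables (X Y : finType) (S T : finMonoidType).
Variables (a : transMonoid X S) (b : transMonoid Y T).

Local Notation wreath := (wreath a b).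

HB.instance Definition _ := Finite.on wreath.

Definition twist (t : T) (g : {ffun Y -> S}) : {ffun Y -> S} :=
  [ffun y => g (b y t)].

Definition wreath_mul (p q : wreath) : wreath :=
  (p.1 * twist p.2 q.1, p.2 * q.2).

Definition wreath_one : wreath := (1, 1).

Fact wreath_mulA : associative wreath_mul.
Proof.
move=> [f t] [g u] [h v]; rewrite /wreath_mul /= !mulgA; congr (_, _).
by apply/ffunP=> y; rewrite !ffunE !mulgA tm_actM.
Qed.

Fact wreath_mul1 : left_id wreath_one wreath_mul.
Proof.
move=> [f t]; rewrite /wreath_mul /= !mul1g; congr (_, _).
by apply/ffunP=> y; rewrite !ffunE tm_act1.
Qed.

Fact wreath_mulr1 : right_id wreath_one wreath_mul.
Proof.
move=> [f t]; rewrite /wreath_mul /= !mulg1; congr (_, _).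
by apply/ffunP=> y; rewrite !ffunE mulg1.
Qed.

HB.instance Definition _ :=
  isMonoid.Build wreath wreath_mulA wreath_mul1 wreath_mulr1.

End WreathProduct.

(* Main.v *)
Require Import Defs.
From mathcomp Require Import all_boot.
From mathcomp Require Import boolp.

(** Write W for the wreath product, U for the group of units of S, and take a
    minimum generating set B of S whose letters reach ker(S) in N(S) steps, a
    minimum generating set C of T that does the same for T, and a minimum
    generating set G of U^Y. The set

      A = G  +  { b placed at coordinate y | y in Y, b in B non-unit }
             +  { (1, c) | c in C, c <> 1 }

    generates W, because every f in S^Y is the product of its coordinates and
    (f, t) = (f, 1)(1, t).

    A has minimum size ([rank_wreath_ge], [rank_power_ge]). The reason is that
    units of a finite monoid form a face: a product of elements is a unit only
    if all of them are. Hence requiring some coordinates of f to be units, or t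
    to be 1, cuts out a submonoid P of W such that any generating set of W
    meets P in a generating set of P ([generates_face]). Taking for P the units
    of W one finds rank(U^Y) letters that are units; taking for P the pairs
    (f, 1) with f a unit away from y, and projecting to the coordinate y, one
    finds as many letters non-unit exactly at y as B has non-units
    ([nonunits_min_le]); projecting to T one finds as many letters outside
    S^Y x 1 as C has elements other than 1. These classes of letters are
    disjoint.

    Now let k in ker(S) and t in ker(T) be elements of lengths N(S) and N(T).
    The pair (constant k, t) lies in ker(W) ([mem_ker_wreath]). The constant
    function at a non-unit b of B is a product of |Y| letters of A, and at a unit
    of B it is a product of at most d letters, where d bounds the lengths of
    these constant functions over G; so (constant k, t) has length at most
    max(|Y|, d) N(S) + N(T) ([Nker_wreath_le]). For G = A' one can take
    d = diam(U^Y, A'). If rank(U^k) = k rank(U), the units of B placed at single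
    coordinates form a minimum generating set G of U^Y, and d = |Y|. *)

Set Implicit Arguments.
Unset Strict Implicit.
Unset Printing Implicit Defensive.

Local Open Scope group_scope.

(** * Generating sets, rank and N *)

Lemma least_sat (P : nat -> Prop) n : P n -> P (least P).
Proof. by case/leastP. Qed.

Lemma least_min (P : nat -> Prop) n : P n -> least P <= n.
Proof. by move=> Pn; have [_ ->] := leastP Pn. Qed.

Section Generation.

Variable R : finSemigroupType.
Implicit Types (A : {set R}) (x : R).

Lemma product_ofM A i j x y :
  product_of A i x -> product_of A j y -> product_of A (i + j) (x * y).
Proof.
move=> Ax; elim=> [a Aa | k s b _ IH Ab]; first by rewrite addn1; apply: ProductS.
by rewrite addnS mulgA; apply: ProductS.
Qed.

Lemma product_of_generates A :
  R -> (forall x, exists k, product_of A k x) -> generates A.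
Proof.
move=> x0 genA; split=> //; apply/set0Pn.
by have [k] := genA x0; elim=> [a Aa | //]; exists a.
Qed.

Lemma rank_le A : generates A -> rank R <= #|A|.
Proof. by move=> genA; apply: least_min; exists A. Qed.

Variable x0 : R.

Lemma generates_setT : generates [set: R].
Proof.
by apply: (product_of_generates x0) => x; exists 1%N; constructor; rewrite inE.
Qed.

Lemma rank_attained : exists2 A : {set R}, generates A & #|A| = rank R.
Proof.
pose P k := exists2 A : {set R}, generates A & #|A| = k.
by apply: (@least_sat P #|[set: R]|); exists [set: R] => //; apply: generates_setT.
Qed.

Lemma Nker_attained :
  exists A, [/\ generates A, #|A| = rank R & Nker_wrt A = Nker R].
Proof.
have [A genA minA] := rank_attained.
pose P k := exists A : {set R}, [/\ generates A, #|A| = rank R & Nker_wrt A = k].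
by apply: (@least_sat P (Nker_wrt A)); exists A.
Qed.

Lemma Nker_wrt_attained A : exists2 x, x \in ker R & len A x = Nker_wrt A.
Proof.
have /andP[/set0Pn[x kx] _] := ideal_ker x0.
pose P k := exists2 s, s \in ker R & len A s = k.
by apply: (@least_sat P (len A x)); exists x.
Qed.

Lemma Nker_le A x : generates A -> #|A| = rank R -> x \in ker R -> Nker R <= len A x.
Proof.
move=> genA minA kx; apply: (@leq_trans (Nker_wrt A)); apply: least_min.
  by exists A.
by exists x.
Qed.

End Generation.

(** * Faces *)

Section Face.

Variables (R Q : finSemigroupType) (P : pred R) (pi : R -> Q).
Hypothesis faceP : forall x y, P (x * y) -> P x && P y.
Hypothesis piM : forall x y, P x -> P y -> pi (x * y) = pi x * pi y.
Hypothesis pi_onto : forall q, exists2 x, P x & pi x = q.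

(** A product that lies in the face [P] has all its factors in [P], so the
    letters of [A] outside [P] never occur in a word for an element of [P]. *)
Lemma generates_face (A : {set R}) :
  generates A -> generates (pi @: [set x in A | P x]).
Proof.
case=> /set0Pn[a _] genA; apply: (product_of_generates (pi a)) => q.
have [x Px <-] := pi_onto q; have [k Ak] := genA x; exists k.
elim: Ak Px => {k x} [b Ab Pb | k s b _ IH Ab /faceP/andP[Ps Pb]].
  by constructor; apply: imset_f; rewrite inE Ab.
rewrite piM //; apply: ProductS; first exact: IH.
by apply: imset_f; rewrite inE Ab.
Qed.

Lemma rank_face (A : {set R}) : generates A -> rank Q <= #|[set x in A | P x]|.
Proof. by move/generates_face/rank_le/leq_trans; apply; apply: leq_imset_card. Qed.

End Face.

(** * Lengths in a finite monoid *)

Section Reach.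

Variable M : finMonoidType.
Implicit Types (A B : {set M}) (x y : M).

(** The identity counts as a product of no letters: this makes [reach] additive
    under products and matches the convention by which its length is 0. *)
Definition reach A k x := x = 1 \/ exists2 j, j <= k & product_of A j x.

Lemma reach1 A k : reach A k 1. Proof. by left. Qed.

Lemma reach_gen A x : x \in A -> reach A 1 x.
Proof. by move=> Ax; right; exists 1%N => //; constructor. Qed.

Lemma reach_leq A i k x : i <= k -> reach A i x -> reach A k x.
Proof.
by move=> lik [-> | [j lji Ax]]; [left | right; exists j => //; apply: leq_trans lik].
Qed.

Lemma reachM A i j x y : reach A i x -> reach A j y -> reach A (i + j) (x * y).
Proof.
move=> [-> | [i' li Ax]].
  by rewrite mul1g; apply/reach_leq/leq_addl.
move=> [-> | [j' lj Ay]].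
  by rewrite mulg1; right; exists i' => //; apply: leq_trans li (leq_addr _ _).
by right; exists (i' + j'); [apply: leq_add | apply: product_ofM].
Qed.

Lemma is_identity1 : is_identity (1 : M).
Proof. by move=> s; rewrite mul1g mulg1. Qed.

Lemma reach_len A x : generates A -> reach A (len A x) x.
Proof.
move=> [_ genA]; have [k Ax] := genA x; rewrite /len; case: asboolP => [idx | _].
  by left; have [_ <-] := idx 1; rewrite mul1g.
right; exists (least (fun k => product_of A k x)) => //.
exact: (@least_sat (fun k => product_of A k x) _ Ax).
Qed.

Lemma len_reach A k x : reach A k x -> len A x <= k.
Proof.
rewrite /len; case: asboolP => // nid [x1 | [j ljk Ax]].
  by case: nid; rewrite x1; apply: is_identity1.
exact: leq_trans (@least_min (fun k => product_of A k x) _ Ax) ljk.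
Qed.

Lemma reach_diam A x : generates A -> reach A (diam A) x.
Proof. by move/(reach_len x); apply/reach_leq/leq_bigmax. Qed.

(** Generation as a semigroup is generation as a monoid together with a nonempty
    word for the identity. *)
Lemma reach_generates A :
  (exists k, product_of A k 1) -> (forall x, exists k, reach A k x) -> generates A.
Proof.
move=> [k1 A1] reachA; apply: (product_of_generates 1) => x.
by have [k [-> | [j _ Ax]]] := reachA x; [exists k1 | exists j].
Qed.

End Reach.

Lemma product_of_morph (M N : finSemigroupType) (phi : M -> N)
    (A : {set M}) (B : {set N}) k x :
  {morph phi : x y / x * y} -> (forall a, a \in A -> phi a \in B) ->
  product_of A k x -> product_of B k (phi x).
Proof.
move=> phiM AB; elim=> [a /AB | {}k s a _ IH /AB Ba]; first by constructor.
by rewrite phiM; apply: ProductS.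
Qed.

Lemma reach_morph (M N : finMonoidType) (phi : M -> N)
    (A : {set M}) (B : {set N}) d k x :
  phi 1 = 1 -> {morph phi : x y / x * y} ->
  (forall a, a \in A -> reach B d (phi a)) ->
  reach A k x -> reach B (d * k) (phi x).
Proof.
move=> phi1 phiM AB [-> | [j ljk Ax]]; first by rewrite phi1; apply: reach1.
apply: (@reach_leq _ _ (d * j)); first by rewrite leq_mul2l ljk orbT.
elim: Ax => {j ljk x} [a Aa | j s a _ IH Aa]; first by rewrite muln1; apply: AB.
by rewrite phiM mulnS addnC; apply: reachM (AB _ Aa).
Qed.

(** * Units and the rank of a finite monoid *)

Section Units.

Variable M : finMonoidType.
Implicit Types (A : {set M}) (G : {set unit_group M}) (x y : M).

(** If [x * y = 1], left multiplication by [y] is injective, hence onto, and the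
    right inverse of [y] obtained in this way is [x]. *)
Lemma mulg1_comm x y : x * y = 1 -> y * x = 1.
Proof.
move=> xy1; have injy : injective (fun z => y * z).
  by move=> z1 z2 /(congr1 (fun z => x * z)); rewrite !mulgA xy1 !mul1g.
have [f _ fK] := injF_bij injy.
have yf : y * f 1 = 1 := fK 1.
by rewrite -[x]mulg1 -{1}yf [x * _]mulgA xy1 mul1g.
Qed.

Lemma unitsP x : reflect (exists y, x * y = 1) (x \in units M).
Proof.
rewrite inE; apply: (iffP existsP) => -[y]; first by case/andP=> /eqP; exists y.
by move=> xy; exists y; rewrite xy mulg1_comm ?eqxx.
Qed.

Lemma unitsM x y : (x * y \in units M) = (x \in units M) && (y \in units M).
Proof.
apply/idP/andP=> [/unitsP[z xyz] | [Ux Uy]]; last first.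
  exact: (proj2 (units_closed M)).
split; apply/unitsP; first by exists (y * z); rewrite mulgA.
by exists (z * x); apply: mulg1_comm; rewrite -mulgA; apply: mulg1_comm.
Qed.

Lemma units1 : 1 \in units M.
Proof. by apply/unitsP; exists 1; rewrite mulg1. Qed.

(** Left inverse of the inclusion of the group of units; non-units go to 1. *)
Definition to_unit x : unit_group M := insubd (1 : unit_group M) x.

Lemma to_unitK x : x \in units M -> unit_val (to_unit x) = x.
Proof. by move=> Ux; rewrite -[LHS]/(val (to_unit x)) val_insubd Ux. Qed.

Lemma unit_val_inj : injective (@unit_val M).
Proof. exact: val_inj. Qed.

Lemma unit_val1 : unit_val (1 : unit_group M) = 1. Proof. by []. Qed.

Lemma unit_valM : {morph @unit_val M : u v / u * v}.
Proof. by []. Qed.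

Lemma unit_valK : cancel (@unit_val M) to_unit.
Proof. by move=> u; apply: unit_val_inj; rewrite to_unitK ?unit_valP. Qed.

Lemma generates_units A : generates A -> generates (to_unit @: (A :&: units M)).
Proof.
have -> : A :&: units M = [set x in A | x \in units M].
  by apply/setP=> x; rewrite !inE.
apply: (@generates_face _ _ (mem (units M))) => [x y | x y Ux Uy | u].
- by rewrite /= unitsM.
- by apply: unit_val_inj; rewrite unit_valM !to_unitK // unitsM; apply/andP.
- by exists (unit_val u); [apply: unit_valP | rewrite unit_valK].
Qed.

Lemma rank_units_le A : generates A -> rank (unit_group M) <= #|A :&: units M|.
Proof. by move/generates_units/rank_le/leq_trans; apply; apply: leq_imset_card. Qed.

(** The units among the letters can be exchanged for any generating set of the
    group of units. *)
Lemma generates_nonunitsU A G :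
  generates A -> generates G -> generates ((A :\: units M) :|: @unit_val M @: G).
Proof.
move=> genA genG; set B := _ :|: _.
have GB u : u \in G -> unit_val u \in B by move=> Gu; rewrite inE imset_f ?orbT.
have reachU u : reach B (1 * diam G) (unit_val u).
  apply: (reach_morph unit_val1 unit_valM) (reach_diam _ genG) => v Gv.
  exact/reach_gen/GB.
apply: reach_generates.
  have [_ /(_ 1)[k Gk]] := genG; exists k.
  exact: (product_of_morph unit_valM GB Gk).
move=> x; exists (maxn 1 (diam G) * len A x)%N.
apply: (@reach_morph _ _ id A) => //; last exact: reach_len.
move=> s As; have [Us | nUs] := boolP (s \in units M).
  rewrite -(to_unitK Us); apply: reach_leq (reachU _).
  by rewrite mul1n leq_maxr.
by apply: reach_leq (leq_maxl _ _) (reach_gen _); rewrite inE in_setD nUs As.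
Qed.

Lemma rank_le_nonunits A :
  generates A -> rank M <= #|A :\: units M| + rank (unit_group M).
Proof.
move=> genA; have [G genG <-] := rank_attained (1 : unit_group M).
apply: leq_trans (rank_le (generates_nonunitsU genA genG)) _.
apply: leq_trans (leq_card_setU _ _) _.
by rewrite leq_add2l leq_imset_card.
Qed.

(** A minimum generating set is minimum separately on units and on non-units,
    since the two parts can be exchanged independently. *)
Lemma card_units_min A : generates A -> #|A| = rank M ->
  #|A :&: units M| = rank (unit_group M).
Proof.
move=> genA cardA; apply/eqP; rewrite eqn_leq rank_units_le // andbT.
have := rank_le_nonunits genA.
by rewrite -cardA -(cardsID (units M) A) addnC leq_add2l.
Qed.

Lemma card_nonunits_min A : generates A -> #|A| = rank M ->
  #|A :\: units M| + rank (unit_group M) = rank M.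
Proof. by move=> genA minA; rewrite -(card_units_min genA minA) addnC cardsID. Qed.

Lemma nonunits_min_le A B : generates A -> #|A| = rank M -> generates B ->
  #|A :\: units M| <= #|B :\: units M|.
Proof.
move=> genA cardA /rank_le_nonunits.
by rewrite -(card_nonunits_min genA cardA) leq_add2r.
Qed.

End Units.

(** * The minimum ideal *)

Section Kernel.

Variable M : finMonoidType.
Implicit Types (k x : M).

Lemma ker_mulmul k x : k \in ker M -> exists p q, k = p * x * q.
Proof.
set I : {set M} := [set z | [exists p, exists q, z == p * x * q]].
have idI : ideal I.
  apply/andP; split.
    apply/set0Pn; exists x; rewrite inE; apply/existsP; exists 1; apply/existsP; exists 1.
    by rewrite mul1g mulg1.
  apply/forallP=> s; apply/forall_inP=> z; rewrite inE.
  case/existsP=> p /existsP[q /eqP->]; rewrite !inE; apply/andP; split.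
    by apply/existsP; exists (s * p); apply/existsP; exists q; rewrite !mulgA.
  by apply/existsP; exists p; apply/existsP; exists (q * s); rewrite !mulgA.
move/(subsetP (ker_sub idI)); rewrite inE => /existsP[p /existsP[q /eqP->]].
by exists p, q.
Qed.

(** The minimum ideal of a finite monoid is a union of minimal left ideals:
    writing [k = p * (x * k) * q], right multiplication by [q] maps the left ideal
    of [p * (x * k)] onto that of [k], so by cardinality the left ideal of [x * k],
    which lies in that of [k], is equal to it. *)
Lemma ker_left_simple k x : k \in ker M -> exists p, k = p * x * k.
Proof.
move=> kk; have [p [q def_k]] := ker_mulmul (x * k) kk.
pose L z : {set M} := [set s * z | s : M].
have LM s z : L (s * z) \subset L z.
  by apply/subsetP=> _ /imsetP[r _ ->]; apply/imsetP; exists (r * s); rewrite ?mulgA.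
have le1 : #|L k| <= #|L (p * (x * k))|.
  have -> : L k = (fun z => z * q) @: L (p * (x * k)).
    by rewrite {1}def_k /L -imset_comp; apply: eq_imset => s /=; rewrite !mulgA.
  exact: leq_imset_card.
have /eqP eqL : L (x * k) == L k.
  by rewrite eqEcard LM (leq_trans le1 (subset_leq_card (LM _ _))).
have : k \in L (x * k) by rewrite eqL; apply/imsetP; exists 1; rewrite ?mul1g.
by case/imsetP=> s _ def; exists s; rewrite -mulgA.
Qed.

End Kernel.

(** * Direct powers *)

Section Power.

Variables (Y : finType).

Definition single (M : finMonoidType) (y : Y) (s : M) : {ffun Y -> M} :=
  [ffun z => if z == y then s else 1].

Section Monoid.
Variable M : finMonoidType.
Implicit Types (f g : {ffun Y -> M}) (s : M).

Lemma ffun_mulE f g y : (f * g) y = f y * g y.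
Proof. by rewrite ffunE. Qed.

Lemma single1 y : single y (1 : M) = 1.
Proof. by apply/ffunP=> z; rewrite !ffunE if_same. Qed.

Lemma singleM y : {morph @single M y : s t / s * t}.
Proof. by move=> s t; apply/ffunP=> z; rewrite !ffunE; case: eqP; rewrite ?mulg1. Qed.

(** A function is the product of its coordinates. *)
Lemma reach_ffun (A : {set {ffun Y -> M}}) (k : Y -> nat) f :
  (forall y, reach A (k y) (single y (f y))) -> reach A (\sum_y k y) f.
Proof.
move=> reachf.
have fE : f = [ffun z => if z \in index_enum Y then f z else 1].
  by apply/ffunP=> z; rewrite !ffunE mem_index_enum.
(* Induction on the list of coordinates at which [f] has been built so far. *)
rewrite {}[X in reach _ _ X]fE.
elim: (index_enum Y) (index_enum_uniq Y) => /= [_|y s IH].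
  rewrite big_nil.
  have -> : [ffun z => if z \in [::] then f z else 1] = 1 :> {ffun Y -> M}.
    by apply/ffunP=> z; rewrite !ffunE.
  exact: reach1.
case/andP=> nsy /IH{}IH; rewrite big_cons.
have -> : [ffun z => if z \in y :: s then f z else 1] =
          single y (f y) * [ffun z => if z \in s then f z else 1].
  apply/ffunP=> z; rewrite !ffunE inE; case: eqVneq => [-> | _] /=.
    by rewrite (negbTE nsy) mulg1.
  by rewrite mul1g.
exact: reachM.
Qed.

Definition const_ffun (s : M) : {ffun Y -> M} := [ffun=> s].

Lemma const_ffun1 : const_ffun 1 = 1.
Proof. by apply/ffunP=> z; rewrite !ffunE. Qed.

Lemma const_ffunM : {morph const_ffun : s t / s * t}.
Proof. by move=> s t; apply/ffunP=> z; rewrite !ffunE. Qed.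

Definition single_gens (H : {set M}) : {set {ffun Y -> M}} :=
  [set single p.1 p.2 | p in setX [set: Y] H].

Lemma mem_single_gens (H : {set M}) y s : s \in H -> single y s \in single_gens H.
Proof. by move=> Hs; apply/imsetP; exists (y, s); rewrite // in_setX in_setT. Qed.

Lemma card_single_gens (H : {set M}) : #|single_gens H| <= #|Y| * #|H|.
Proof. by apply: leq_trans (leq_imset_card _ _) _; rewrite cardsX cardsT. Qed.

Lemma single_gens_generates (H : {set M}) :
  0 < #|Y| -> generates H -> generates (single_gens H).
Proof.
case/card_gt0P=> y _ genH; apply: reach_generates.
  (* A nonempty word for 1 needs a coordinate at which to place one. *)
  have [_ /(_ 1)[k Hk]] := genH; exists k; rewrite -(single1 y).
  exact: product_of_morph (singleM y) (@mem_single_gens H y) Hk.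
move=> f; exists (\sum_y (1 * len H (f y)))%N; apply: reach_ffun => z.
apply: (reach_morph (single1 z) (singleM z)) (reach_len _ genH) => s Hs.
exact/reach_gen/mem_single_gens.
Qed.

End Monoid.

Variable S : finMonoidType.
Implicit Types (f g : {ffun Y -> S}) (u v : {ffun Y -> unit_group S}).
Implicit Types (G : {set {ffun Y -> unit_group S}}) (B : {set S}).

Definition units_emb u : {ffun Y -> S} := [ffun y => unit_val (u y)].

Lemma units_emb1 : units_emb 1 = 1.
Proof. by apply/ffunP=> z; rewrite !ffunE. Qed.

Lemma units_embM : {morph units_emb : u v / u * v}.
Proof. by move=> u v; apply/ffunP=> z; rewrite !ffunE. Qed.

Lemma units_emb_single y (s : unit_group S) :
  units_emb (single y s) = single y (unit_val s).
Proof. by apply/ffunP=> z; rewrite !ffunE; case: eqP. Qed.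

Definition power_gens (G : {set {ffun Y -> unit_group S}}) (B : {set S}) :
    {set {ffun Y -> S}} :=
  (units_emb @: G) :|: single_gens (B :\: units S).

Lemma card_power_gens G B :
  #|power_gens G B| <= #|G| + #|Y| * #|B :\: units S|.
Proof.
apply: leq_trans (leq_card_setU _ _) (leq_add (leq_imset_card _ _) _).
exact: card_single_gens.
Qed.

Lemma power_gens_unit G B u : u \in G -> units_emb u \in power_gens G B.
Proof. by move=> Gu; rewrite inE imset_f. Qed.

Lemma power_gens_single G B y b :
  b \in B -> b \notin units S -> single y b \in power_gens G B.
Proof.
by move=> Bb nUb; rewrite inE mem_single_gens ?orbT // in_setD nUb.
Qed.

Lemma reach_power_unit G B k u :
  reach G k u -> reach (power_gens G B) k (units_emb u).
Proof.
rewrite -[X in reach (power_gens _ _) X]mul1n.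
apply: (reach_morph units_emb1 units_embM) => v Gv.
exact/reach_gen/power_gens_unit.
Qed.

Lemma reach_power_const G B d b : b \in B -> #|Y| <= d ->
  (forall s, s \in B -> s \in units S -> reach G d (const_ffun (to_unit s))) ->
  reach (power_gens G B) d (const_ffun b).
Proof.
move=> Bb leYd reachU; have [Ub | nUb] := boolP (b \in units S).
  have -> : const_ffun b = units_emb (const_ffun (to_unit b)).
    by apply/ffunP=> y; rewrite !ffunE to_unitK.
  exact/reach_power_unit/reachU.
apply: reach_leq leYd _; rewrite -sum1_card; apply: reach_ffun => y.
by rewrite ffunE; apply/reach_gen/power_gens_single.
Qed.

Lemma power_gens_generates G B :
  generates G -> generates B -> generates (power_gens G B).
Proof.
move=> genG genB; apply: reach_generates.
  have [_ /(_ 1)[k Gk]] := genG; exists k; rewrite -units_emb1.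
  exact: product_of_morph units_embM (@power_gens_unit G B) Gk.
move=> f; pose d := maxn 1 (diam G).
exists (\sum_y (d * len B (f y)))%N; apply: reach_ffun => y.
apply: (reach_morph (single1 _ y) (singleM y)) (reach_len _ genB) => b Bb.
have [Ub | nUb] := boolP (b \in units S).
  rewrite -(to_unitK Ub) -units_emb_single; apply: reach_power_unit.
  exact: reach_leq (leq_maxr _ _) (reach_diam _ genG).
exact: reach_leq (leq_maxl _ _) (reach_gen (power_gens_single _ _ Bb nUb)).
Qed.

(** Sort the letters of a generating set [D] by the set of coordinates at which
    they are not units. Those with no such coordinate must generate the group of
    units. Those with at most the coordinate [y] project onto a generating set of
    [S], so the ones with exactly [y] are at least as many as the non-units of a
    minimum generating set of [S]. *)
Lemma rank_power_ge (D : {set {ffun Y -> S}}) (B : {set S}) :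
  generates D -> generates B -> #|B| = rank S ->
  rank {ffun Y -> unit_group S} + #|Y| * #|B :\: units S| <= #|D|.
Proof.
move=> genD genB minB.
pose DU := [set f in D | [forall y, f y \in units S]].
pose F y := [set f in D | (f y \notin units S) &&
                          [forall (z | z != y), f z \in units S]].
have rankU : rank {ffun Y -> unit_group S} <= #|DU|.
  apply: (@rank_face _ _ (fun f => [forall y, f y \in units S])
            (fun f => [ffun y => to_unit (f y)])) genD => [f g | f g Uf Ug | u].
  - move/forallP=> Ufg; apply/andP; split; apply/forallP=> y;
      by have := Ufg y; rewrite ffun_mulE unitsM => /andP[].
  - apply/ffunP=> y; apply: unit_val_inj.
    rewrite !ffunE unit_valM !to_unitK ?(forallP Uf) ?(forallP Ug) //.
    by rewrite unitsM (forallP Uf) (forallP Ug).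
  - exists (units_emb u); first by apply/forallP=> y; rewrite ffunE; apply: unit_valP.
    by apply/ffunP=> y; rewrite !ffunE unit_valK.
have rankF y : #|B :\: units S| <= #|F y|.
  pose P f := [forall (z | z != y), f z \in units S].
  have genS : generates ((fun f => f y) @: [set f in D | P f]).
    apply: (@generates_face _ _ P) genD => [f g | f g _ _ | s].
    - move/forall_inP=> Ufg; apply/andP; split; apply/forall_inP=> z zy;
        by have := Ufg z zy; rewrite ffun_mulE unitsM => /andP[].
    - by rewrite ffun_mulE.
    - exists (single y s); last by rewrite ffunE eqxx.
      by apply/forall_inP=> z /negbTE zy; rewrite ffunE zy units1.
  apply: leq_trans (nonunits_min_le genB minB genS) _.
  apply: leq_trans (leq_imset_card (fun f => f y) (F y)).
  apply/subset_leq_card/subsetP=> s; rewrite in_setD => /andP[nUs /imsetP[f]].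
  rewrite inE => /andP[Df Pf] def_s; apply/imsetP; exists f => //.
  by rewrite inE Df -def_s nUs; apply: Pf.
have disjF y z : y != z -> [disjoint F y & F z].
  move=> yz; rewrite -setI_eq0; apply/eqP/setP=> f; rewrite !inE.
  apply/negP=> /andP[/and3P[_ nUy _] /and3P[_ _ /forall_inP/(_ y yz)]].
  by rewrite inE (negbTE nUy).
have cardF : #|\bigcup_y F y| = \sum_y #|F y|.
  by rewrite -sum1_card partition_disjoint_bigcup //; under eq_bigr do rewrite sum1_card.
have disjU : [disjoint DU & \bigcup_y F y].
  rewrite -setI_eq0; apply/eqP/setP=> f; rewrite !inE.
  apply/negP=> /andP[/andP[_ /forallP Uf] /bigcupP[y _]].
  by rewrite inE Uf andbF.
apply: (@leq_trans #|DU :|: \bigcup_y F y|); last first.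
  apply/subset_leq_card/subsetP=> f; rewrite inE.
  by case/orP=> [|/bigcupP[y _]]; rewrite inE => /andP[].
rewrite cardsU disjoint_setI0 // cards0 subn0 leq_add // cardF -sum_nat_const.
exact: leq_sum.
Qed.

End Power.

(** Restriction along the enumeration of [Y] maps the one power onto the other,
    and a quotient does not have larger rank. *)
Lemma rank_ffun_enum (Y : finType) (M : finMonoidType) :
  rank {ffun 'I_#|Y| -> M} <= rank {ffun Y -> M}.
Proof.
have [A genA <-] := rank_attained (1 : {ffun Y -> M}).
pose pi (f : {ffun Y -> M}) : {ffun 'I_#|Y| -> M} := [ffun i => f (enum_val i)].
apply: leq_trans (rank_face (P := predT) (pi := pi) _ _ _ genA) _ => //.
- by move=> f g _ _; apply/ffunP=> i; rewrite !ffunE.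
- move=> g; exists [ffun y => g (enum_rank y)] => //.
  by apply/ffunP=> i; rewrite !ffunE enum_valK.
- by apply/subset_leq_card/subsetP=> f; rewrite inE => /andP[].
Qed.

(** * The wreath product *)

Section Wreath.

Variables (X Y : finType) (S T : finMonoidType).
Variables (a : transMonoid X S) (b : transMonoid Y T).
Hypothesis units_T : units T = [set 1].

Local Notation W := (wreath a b).
Implicit Types (f g : {ffun Y -> S}) (t u : T) (A : {set {ffun Y -> S}}) (C : {set T}).

Definition inl_wreath (f : {ffun Y -> S}) : W := (f, 1).
Definition inr_wreath (t : T) : W := (1, t).

Lemma wreath_mulE (p q : W) : p * q = (p.1 * twist b p.2 q.1, p.2 * q.2).
Proof. by []. Qed.

Lemma twist1 (g : {ffun Y -> S}) : twist b 1 g = g.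
Proof. by apply/ffunP=> y; rewrite ffunE tm_act1. Qed.

Lemma inl_wreath1 : inl_wreath 1 = 1. Proof. by []. Qed.

Lemma inl_wreathM : {morph inl_wreath : f g / f * g}.
Proof. by move=> f g; rewrite wreath_mulE /= twist1 mulg1. Qed.

Lemma inr_wreath1 : inr_wreath 1 = 1. Proof. by []. Qed.

Lemma inr_wreathM : {morph inr_wreath : t u / t * u}.
Proof.
move=> t u; rewrite wreath_mulE /=; congr (_, _).
by apply/ffunP=> y; rewrite !ffunE mulg1.
Qed.

Lemma wreath_split f t : inl_wreath f * inr_wreath t = (f, t).
Proof. by rewrite wreath_mulE /= twist1 mulg1 mul1g. Qed.

(** Only constant functions are treated: for an arbitrary [f] with values in
    [ker S] the pair [(f, t)] may lie outside the kernel. Any [(g, u)] is carried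
    to [(const k, t)] as [(h, t1) (g, u) (const k, t2)] with [t = t1 * u * t2];
    the constant right factor is unaffected by the twist, so only
    [h y * g (y t1) * k = k] is needed at each [y], which is left simplicity. *)
Lemma mem_ker_wreath k t :
  k \in ker S -> t \in ker T -> ((const_ffun Y k, t) : W) \in ker W.
Proof.
move=> kk kt; apply/bigcapP=> I /andP[/set0Pn[[g u] Igu] /forallP idI].
have idl s x : x \in I -> s * x \in I.
  by move=> Ix; have /forall_inP/(_ x Ix)/andP[] := idI s.
have idr s x : x \in I -> x * s \in I.
  by move=> Ix; have /forall_inP/(_ x Ix)/andP[] := idI s.
have [t1 [t2 ->]] := ker_mulmul u kt.
have /fin_all_exists[h hE] y : exists p, k = p * g (b y t1) * k := ker_left_simple _ kk.
suff -> : ((const_ffun Y k, t1 * u * t2) : W)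
          = (([ffun y => h y], t1) : W) * ((g, u) : W) * ((const_ffun Y k, t2) : W).
  exact/idr/idl.
rewrite !wreath_mulE /=; congr (_, _).
by apply/ffunP=> y; rewrite !ffunE -hE.
Qed.

Definition wreath_gens (A : {set {ffun Y -> S}}) (C : {set T}) : {set W} :=
  (inl_wreath @: A) :|: (inr_wreath @: (C :\: units T)).

Lemma card_wreath_gens A C : #|wreath_gens A C| <= #|A| + #|C :\: units T|.
Proof.
by apply: leq_trans (leq_card_setU _ _) (leq_add _ _); apply: leq_imset_card.
Qed.

Lemma wreath_gens_inl A C f : f \in A -> inl_wreath f \in wreath_gens A C.
Proof. by move=> Af; rewrite inE imset_f. Qed.

Lemma reach_wreath A C i j f t :
  reach A i f -> reach C j t -> reach (wreath_gens A C) (i + j) ((f, t) : W).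
Proof.
move=> Af Ct; rewrite -wreath_split -[i]mul1n -[j]mul1n; apply: reachM.
  apply: (reach_morph inl_wreath1 inl_wreathM) Af => g Ag.
  exact/reach_gen/wreath_gens_inl.
apply: (reach_morph inr_wreath1 inr_wreathM) Ct => c Cc.
have [Uc | nUc] := boolP (c \in units T).
  by move: Uc; rewrite units_T inE => /eqP->; apply: reach1.
by apply: reach_gen; rewrite inE orbC imset_f // in_setD nUc.
Qed.

Lemma wreath_gens_generates A C :
  generates A -> generates C -> generates (wreath_gens A C).
Proof.
move=> genA genC; apply: reach_generates.
  have [_ /(_ 1)[k Ak]] := genA; exists k.
  exact: (product_of_morph inl_wreathM (@wreath_gens_inl A C) Ak).
move=> [f t]; exists (len A f + len C t)%N.
by apply: reach_wreath; apply: reach_len.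
Qed.

(** As [T] has no unit but 1, the pairs [(f, 1)] form a face isomorphic to the
    direct power; the other letters have to supply the non-units of [T]. *)
Lemma rank_wreath_ge (C : {set T}) : generates C -> #|C| = rank T ->
  rank {ffun Y -> S} + #|C :\: units T| <= rank W.
Proof.
move=> genC minC; have [D genD <-] := rank_attained (1 : W).
have rank1 : rank {ffun Y -> S} <= #|[set p in D | p.2 \in units T]|.
  apply: (@rank_face _ _ (fun p : W => p.2 \in units T) (fun p => p.1)) genD.
  - by move=> p q; rewrite wreath_mulE unitsM.
  - move=> p q; rewrite units_T => /set1P p1 _.
    by rewrite wreath_mulE p1 /= twist1.
  - by move=> f; exists (inl_wreath f) => //=; apply: units1.
have genT : generates ((fun p : W => p.2) @: [set p in D | predT p]).
  by apply: generates_face genD => // t; exists (inr_wreath t).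
have rank2 : #|C :\: units T| <= #|[set p in D | p.2 \notin units T]|.
  apply: leq_trans (nonunits_min_le genC minC genT) _.
  apply: leq_trans (leq_imset_card (fun p : W => p.2) _).
  apply/subset_leq_card/subsetP=> t; rewrite in_setD => /andP[nUt /imsetP[p]].
  rewrite inE andbT => Dp def_t; apply/imsetP; exists p => //.
  by rewrite inE Dp -def_t.
apply: leq_trans (leq_add rank1 rank2) _.
rewrite -(cardsID [set p : W | p.2 \in units T] D).
by rewrite leq_add //; apply/subset_leq_card/subsetP=> p; rewrite !inE // andbC.
Qed.

(** The common form of both bounds: [d] bounds, over the generating set [G] of the
    group of units of the power, the lengths of the constant functions at units of
    [B], and over the letters at single coordinates those at non-units. *)
Lemma Nker_wreath_le (B : {set S}) (G : {set {ffun Y -> unit_group S}}) d :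
  generates B -> #|B| = rank S -> Nker_wrt B = Nker S ->
  generates G -> #|G| = rank {ffun Y -> unit_group S} ->
  #|Y| <= d ->
  (forall s, s \in B -> s \in units S -> reach G d (const_ffun Y (to_unit s))) ->
  Nker W <= d * Nker S + Nker T.
Proof.
move=> genB minB NB genG minG leYd reachG.
have [C [genC minC NC]] := Nker_attained (1 : T).
pose A := power_gens G B; pose A2 := wreath_gens A C.
have genA : generates A by apply: power_gens_generates.
have genA2 : generates A2 by apply: wreath_gens_generates.
have minA2 : #|A2| = rank W.
  apply/eqP; rewrite eqn_leq rank_le // andbT.
  apply: leq_trans (card_wreath_gens _ _) (leq_trans _ (rank_wreath_ge genC minC)).
  rewrite leq_add2r.
  have [D genD <-] := rank_attained (1 : {ffun Y -> S}).
  apply: leq_trans (card_power_gens _ _) _; rewrite minG.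
  exact: rank_power_ge.
have [k kk lenk] := Nker_wrt_attained (1 : S) B.
have [t kt lent] := Nker_wrt_attained (1 : T) C.
apply: leq_trans (Nker_le genA2 minA2 (mem_ker_wreath kk kt)) (len_reach _).
rewrite -NB -NC -lenk -lent; apply: reach_wreath; last exact: reach_len.
apply: (reach_morph (const_ffun1 _ _) (@const_ffunM Y S)) (reach_len _ genB) => s Bs.
exact: reach_power_const.
Qed.

End Wreath.

Lemma faithful_nontrivial (Y : finType) (T : finMonoidType) (b : transMonoid Y T) :
  (exists t : T, t <> 1) -> 0 < #|Y|.
Proof.
case=> t t1; rewrite lt0n; apply/negP=> /eqP Y0; apply: t1.
by apply: (@tm_faithful _ _ b) => y; have := fintype0 y Y0.
Qed.

Local Close Scope group_scope.

Theorem theorem4p24 (X Y : finType) (S T : finMonoidType)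
    (a : transMonoid X S) (b : transMonoid Y T) (n : nat)
    (A' : {set {ffun Y -> unit_group S}}) :
  (exists t : T, t <> 1%g) ->
  units T = [set 1%g] ->
  #|Y| = n ->
  generates A' ->
  #|A'| = rank {ffun Y -> unit_group S} ->
  Nker (wreath a b) <= maxn n (diam A') * Nker S + Nker T
  /\ ((forall k : nat, 1 <= k ->
         rank {ffun 'I_k -> unit_group S} = k * rank (unit_group S)) ->
      Nker (wreath a b) <= n * Nker S + Nker T).
Proof.
move=> nontrivT unitsT <- genA' minA'.
have Y_gt0 := faithful_nontrivial b nontrivT.
have [B [genB minB NB]] := Nker_attained (1%g : S).
split=> [|rankU].
  apply: (Nker_wreath_le a b unitsT genB minB NB genA' minA') => [|s _ _].
    exact: leq_maxl.
  exact: reach_leq (leq_maxr _ _) (reach_diam _ genA').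
(* The units of [B] generate the units of [S], and there are just rank many. *)
pose H := @to_unit S @: (B :&: units S); pose G := single_gens Y H.
have genH : generates H by apply: generates_units.
have genG : generates G by apply: single_gens_generates.
have minG : #|G| = rank {ffun Y -> unit_group S}.
  apply/eqP; rewrite eqn_leq rank_le // andbT.
  apply: leq_trans (rank_ffun_enum _ _); rewrite rankU //.
  apply: leq_trans (card_single_gens _ _) _.
  by rewrite leq_mul2l -(card_units_min genB minB) leq_imset_card orbT.
apply: (Nker_wreath_le a b unitsT genB minB NB genG minG) => // s Bs Us.
rewrite -sum1_card; apply: reach_ffun => y; rewrite ffunE.
by apply/reach_gen/mem_single_gens/imset_f; rewrite inE Bs.
Qed.
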